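(* Let $S=(G,\mathbf{P},\Lambda,I)$ be a finite simple semigroup which is not a group, and let $S^\ast=S\cup\{\mathbf{1}\}$ be the monoid obtained from $S$ by adjoining an identity element. If $S$ is an equational domain in the language $\mathcal{L}_S$, then $S^\ast$ is an equational domain in the language $\mathcal{L}_{S^\ast}$.
   Context: A semigroup is simple if it has no (two-sided) ideal other than itself. By the Sushkevich–Rees theorem every finite simple semigroup is, up to isomorphism, of the form $S=(G,\mathbf{P},\Lambda,I)$, where $G$ is a finite group, $\Lambda$ and $I$ are finite nonempty index sets $\{1,\dots,|\Lambda|\}$ and $\{1,\dots,|I|\}$, and $\mathbf{P}=(p_{i\lambda})_{i\in I,\lambda\in\Lambda}$ is a matrix over $G$ with $|I|$ rows and $|\Lambda|$ columns which is normalized, i.e. all elements of its first row and first column equal $1\in G$. The elements of $S$ are the triples $(\lambda,g,i)$ with $\lambda\in\Lambda$, $g\in G$, $i\in I$, and the multiplication is $(\lambda,g,i)(\mu,h,j)=(\lambda,g\,p_{i\mu}h,j)$. $S$ is not a group exactly when $|\Lambda|>1$ or $|I|>1$. In $S^\ast=S\cup\{\mathbf 1\}$ the new element $\mathbf 1\notin S$ satisfies $\mathbf 1 s=s\mathbf 1=s$ for all $s\in S^\ast$. For any semigroup $T$, an $\mathcal{L}_T$-term in variables $x_1,\dots,x_n$ is a finite nonempty product of variables and constants from $T$. An equation over $\mathcal{L}_T$ is an equality of two $\mathcal{L}_T$-terms; a system is an arbitrary set of equations. A set $Y\subseteq T^n$ is algebraic over $\mathcal{L}_T$ if it is the set of all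 solutions in $T^n$ of some system over $\mathcal{L}_T$ in variables $x_1,\dots,x_n$. $T$ is an equational domain in $\mathcal{L}_T$ if for any $n$ and any finite collection of algebraic sets $Y_1,\dots,Y_k\subseteq T^n$ ($k\ge 1$) over $\mathcal{L}_T$ the union $Y_1\cup\dots\cup Y_k$ is algebraic over $\mathcal{L}_T$. *)

(* Defs.v *)
From HB Require Import structures.
From mathcomp Require Import all_boot fingroup matrix.
From mathcomp Require Import classical_sets.

Set Implicit Arguments.
Unset Strict Implicit.
Unset Printing Implicit Defensive.

Local Open Scope group_scope.

Section Semigroups.
Variable T : semigroupType.

Definition is_group :=
  exists2 e : T, (forall x : T, e * x = x /\ x * e = x) &
                 forall x : T, exists y : T, y * x = e /\ x * y = e.

Definition is_ideal (J : set T) :=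
  (exists x, J x) /\ forall x s : T, J x -> J (s * x) /\ J (x * s).

Definition is_simple := forall J : set T, is_ideal J -> forall x, J x.

End Semigroups.

Section Equations.
Variables (T : semigroupType) (n : nat).

(* Since T is associative, the way a product is bracketed is irrelevant. *)
Inductive term : Type :=
  | Var of 'I_n
  | Const of T
  | Mul of term & term.

Fixpoint eval (x : {ffun 'I_n -> T}) (t : term) : T :=
  match t with
  | Var i => x i
  | Const c => c
  | Mul t1 t2 => eval x t1 * eval x t2
  end.

Definition equation : Type := (term * term)%type.

Definition solutions (E : set equation) : set {ffun 'I_n -> T} :=
  [set x | forall e, E e -> eval x e.1 = eval x e.2]%classic.

Definition algebraic (Y : set {ffun 'I_n -> T}) :=
  exists E : set equation, Y = solutions E.

End Equations.

Definition equational_domain (T : semigroupType) :=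
  forall (n k : nat) (Y : 'I_k.+1 -> set {ffun 'I_n -> T}),
    (forall j, algebraic (Y j)) ->
    algebraic (\bigcup_(j in [set: 'I_k.+1]) Y j)%classic.

(* A semigroup with an identity adjoined; None is the new element. *)
Definition adjoin1 (T : semigroupType) : Type := option T.

Section Adjoin1.
Variable T : semigroupType.
Implicit Types x y z : adjoin1 T.

Definition adjoin1_mul x y : adjoin1 T :=
  match x, y with
  | None, _ => y
  | _, None => x
  | Some a, Some b => Some (a * b)
  end.

Lemma adjoin1_mulA : associative adjoin1_mul.
Proof. by move=> [a|] [b|] [c|] //=; rewrite mulgA. Qed.

Lemma adjoin1_mul1g : left_id None adjoin1_mul. Proof. by case. Qed.

Lemma adjoin1_mulg1 : right_id None adjoin1_mul. Proof. by case. Qed.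

HB.instance Definition _ := Choice.copy (adjoin1 T) (option T).
HB.instance Definition _ := isMonoid.Build (adjoin1 T)
  adjoin1_mulA adjoin1_mul1g adjoin1_mulg1.

End Adjoin1.

(* The index sets {1..|I|} and {1..|Lambda|} are 'I_m.+1 and 'I_l.+1; the     *)
(* first index is ord0.                                                       *)
Definition normalized (gT : finGroupType) (m l : nat)
    (P : 'M[gT]_(m.+1, l.+1)) :=
  (forall mu, P ord0 mu = 1) /\ (forall i, P i ord0 = 1).

Record rees (gT : finGroupType) (m l : nat) (P : 'M[gT]_(m.+1, l.+1)) :=
  Rees { rees_l : 'I_l.+1; rees_g : gT; rees_i : 'I_m.+1 }.

Arguments Rees {gT m l} P _ _ _.

Section Rees.
Variables (gT : finGroupType) (m l : nat) (P : 'M[gT]_(m.+1, l.+1)).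
Implicit Types x y : rees P.

Definition rees_triple x := (rees_l x, rees_g x, rees_i x).

Definition triple_rees (u : 'I_l.+1 * gT * 'I_m.+1) : rees P :=
  Rees P u.1.1 u.1.2 u.2.

Lemma rees_tripleK : cancel rees_triple triple_rees. Proof. by case. Qed.

HB.instance Definition _ := Finite.copy (rees P) (can_type rees_tripleK).

Definition rees_mul x y : rees P :=
  Rees P (rees_l x) (rees_g x * P (rees_i x) (rees_l y) * rees_g y) (rees_i y).

Lemma rees_mulA : associative rees_mul.
Proof. by case=> ? ? ? [? ? ?] [? ? ?]; rewrite /rees_mul /= !mulgA. Qed.

HB.instance Definition _ := isSemigroup.Build (rees P) rees_mulA.

Lemma rees_simple : is_simple (rees P).
Proof.
move=> J [[[mu h j] Jx] idJ] [la g i].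
pose s := Rees P la (g * h^-1 * (P j mu)^-1 * (P j mu)^-1) j.
pose t := Rees P mu 1 i.
have [Jsx _] := idJ _ s Jx; have [_] := idJ _ t Jsx.
pose v := g * h^-1 * (P j mu)^-1 * h * P j mu.
suff -> : s * Rees P mu h j * t = Rees P la v i.
  move=> Jv; have [] := idJ _ (Rees P la (g * v^-1 * (P i la)^-1) i) Jv.
  suff -> : Rees P la (g * v^-1 * (P i la)^-1) i * Rees P la v i = Rees P la g i by [].
  by congr Rees; rewrite /= mulgKV mulgKV.
by congr Rees; rewrite /= mulg1 mulgKV.
Qed.

End Rees.

Lemma rees_is_groupP (gT : finGroupType) (m l : nat)
    (P : 'M[gT]_(m.+1, l.+1)) :
  normalized P -> is_group (rees P) <-> l = 0 /\ m = 0.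
Proof.
move=> [P0 _]; split=> [[e idE _]|[l0 m0]].
  split.
    have [/(congr1 (@rees_l _ _ _ P)) /= E1 _] := idE (Rees P ord0 1 ord0).
    have [/(congr1 (@rees_l _ _ _ P)) /= E2 _] := idE (Rees P ord_max 1 ord0).
    by move: E2; rewrite E1 => /(congr1 val).
  have [_ /(congr1 (@rees_i _ _ _ P)) /= E1] := idE (Rees P ord0 1 ord0).
  have [_ /(congr1 (@rees_i _ _ _ P)) /= E2] := idE (Rees P ord0 1 ord_max).
  by move: E2; rewrite E1 => /(congr1 val).
subst l m; have PE i la : P i la = 1 by rewrite (ord1 i) P0.
exists (Rees P ord0 1 ord0) => [[la g i]|[la g i]].
  by rewrite (ord1 la) (ord1 i); split; congr Rees; rewrite /= PE !(mulg1, mul1g).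
exists (Rees P ord0 g^-1 ord0); rewrite (ord1 la) (ord1 i).
by split; congr Rees; rewrite /= PE mulg1 (mulgV, mulVg).
Qed.

(* Main.v *)
Require Import Defs.
From mathcomp Require Import all_boot fingroup matrix.
From mathcomp Require Import boolp classical_sets.

(** Call two elements [a], [b] of a semigroup alike if [c * a * d = c * b * d]
for all [c], [d].  This is a congruence, and the proof rests on the fact that
in an equational domain [S = rees P] alike elements are equal.

Why they are equal: for alike [a], [b] the values of a term at two points with
coordinates in [{a, b}] are alike, and alike elements of [S] that have the same
outer indices coincide.  The left index of a value is that of the first letter
of the term, the right index that of the last letter.  A single letter cannot
express a disjunction, so an equation that holds at [(a, a)], [(a, b)] and
[(b, a)] also holds at [(b, b)] ([rees_equation_square]).  The union of the
algebraic sets [x = a] and [y = a] contains the first three points; being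
algebraic, it contains the fourth, so [a = b] ([alike_eq]).

If [S] is not a group, more is true: two distinct elements of [S*], the new
identity included, are separated by a map [x |-> c * x * d] with [c], [d] in [S]
([sandwich_separates]).  Indeed, if [b] in [S] were not separated from [1], then
[b * z] and [z * b] would be alike to [z] for every [z], hence equal to it, and
[S] would have an identity; a Rees semigroup with an identity is a group.

These maps carry the disjunction from [S*] to [S].  At a point outside a union
[Y_0 \cup ... \cup Y_k], each [Y_j] has an equation [u_j = v_j] that fails, and
it still fails between [c_j * u_j * d_j] and [c_j * v_j * d_j] for suitable
[c_j], [d_j] in [S].  All these values lie in [S], even where [u_j] or [v_j]
takes the value [1].  Since [S] is an equational domain, one equation over [S]
in [2(k+1)] variables follows from the disjunction of the [x_j = y_j] and fails
at the values in question; substituting the sandwiched terms gives an equation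
over [S*] that holds on the union and fails at the given point. *)

Set Implicit Arguments.
Unset Strict Implicit.
Unset Printing Implicit Defensive.

Local Open Scope group_scope.
Local Open Scope classical_set_scope.

Lemma algebraicP (T : semigroupType) n (Y : set {ffun 'I_n -> T}) :
  algebraic Y <->
  forall p, ~ Y p -> exists2 e : equation T n,
    (forall x, Y x -> eval x e.1 = eval x e.2) & eval p e.1 <> eval p e.2.
Proof.
split=> [[E ->] p /existsNP[e /not_implyP[Ee pe]]|sep].
  by exists e => // x; apply.
exists [set e | forall x, Y x -> eval x e.1 = eval x e.2].
apply/seteqP; split=> [x Yx e|p Ep]; first exact.
by apply: contrapT => /sep[e /Ep].
Qed.

Lemma algebraic_eq (T : semigroupType) n (u v : term T n) :
  algebraic [set x | eval x u = eval x v].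
Proof. by apply/algebraicP => p puv; exists (u, v). Qed.

Definition alike (T : semigroupType) (a b : T) :=
  forall c d, c * a * d = c * b * d.

Lemma alikeM (T : semigroupType) (a a' b b' : T) :
  alike a a' -> alike b b' -> alike (a * b) (a' * b').
Proof.
move=> aa' bb' c d; have := aa' c (b * d); rewrite !mulgA => ->.
exact: bb' (c * a') d.
Qed.

Lemma eval_alike (T : semigroupType) n (x y : {ffun 'I_n -> T})
    (t : term T n) :
  (forall i, alike (x i) (y i)) -> alike (eval x t) (eval y t).
Proof. by move=> xy; elim: t => //= t1 IH1 t2 IH2; apply: alikeM. Qed.

Section Rees.
Variables (gT : finGroupType) (m l : nat) (P : 'M[gT]_(m.+1, l.+1)).
Hypothesis P_normalized : normalized P.
Implicit Types a b : rees P.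

(** Normalization makes the middle component of [c * a * d] that of [a] when [c]
and [d] are the idempotent with first indices. *)
Lemma alike_g a b : alike a b -> rees_g a = rees_g b.
Proof.
case: P_normalized => P0 P1 /(_ (Rees P ord0 1 ord0) (Rees P ord0 1 ord0)).
by move/(congr1 (@rees_g _ _ _ P)) => /=; rewrite !P0 !P1 !mulg1 !mul1g.
Qed.

Fixpoint first_letter (T : semigroupType) n (t : term T n) : 'I_n + T :=
  match t with
  | Var i => inl i
  | Const c => inr c
  | Mul t1 _ => first_letter t1
  end.

Fixpoint last_letter (T : semigroupType) n (t : term T n) : 'I_n + T :=
  match t with
  | Var i => inl i
  | Const c => inr c
  | Mul _ t2 => last_letter t2
  end.

Definition letter_value (T : semigroupType) n (x : {ffun 'I_n -> T})
    (w : 'I_n + T) : T :=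
  match w with inl i => x i | inr c => c end.

Lemma rees_l_eval n (x : {ffun 'I_n -> rees P}) t :
  rees_l (eval x t) = rees_l (letter_value x (first_letter t)).
Proof. by elim: t. Qed.

Lemma rees_i_eval n (x : {ffun 'I_n -> rees P}) t :
  rees_i (eval x t) = rees_i (letter_value x (last_letter t)).
Proof. by elim: t. Qed.

Definition point2 (T : Type) (a b : T) : {ffun 'I_2 -> T} :=
  [ffun i : 'I_2 => if i == ord0 then a else b].

(** A letter depends on at most one coordinate: two letters that read the same
coordinate, or no coordinate, are compared at [(b, b)] as at one of the other
points, and letters that read different coordinates agree at [(a, b)] only if
[f a = f b]. *)
Lemma letter_square (T : semigroupType) (A : Type) (f : T -> A) (a b : T)
    (v w : 'I_2 + T) :
  let agree x := f (letter_value x v) = f (letter_value x w) in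
  agree (point2 a a) -> agree (point2 a b) -> agree (point2 b a) ->
  agree (point2 b b).
Proof.
case: v w => [i|c] [j|d] //=; rewrite !ffunE.
- by case: (i == ord0); case: (j == ord0).
- by case: (i == ord0).
- by case: (j == ord0).
Qed.

(** Middle components of values of a term do not change when alike elements are
exchanged; outer indices are governed by single letters. *)
Lemma rees_equation_square a b (s t : term (rees P) 2) :
  let holds x := eval x s = eval x t in
  alike a b ->
  holds (point2 a a) -> holds (point2 a b) -> holds (point2 b a) ->
  holds (point2 b b).
Proof.
move=> holds ab; rewrite /holds => aa ab' ba.
have eg : rees_g (eval (point2 b b) s) = rees_g (eval (point2 b b) t).
  have gab u : rees_g (eval (point2 b b) u) = rees_g (eval (point2 a a) u).
    apply/esym/alike_g/eval_alike => i; rewrite !ffunE.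
    by case: (i == ord0).
  by rewrite !gab aa.
have el : rees_l (eval (point2 b b) s) = rees_l (eval (point2 b b) t).
  rewrite !rees_l_eval; apply: (letter_square (f := @rees_l _ _ _ P) (a := a));
    by rewrite -!rees_l_eval (aa, ab', ba).
have ei : rees_i (eval (point2 b b) s) = rees_i (eval (point2 b b) t).
  rewrite !rees_i_eval; apply: (letter_square (f := @rees_i _ _ _ P) (a := a));
    by rewrite -!rees_i_eval (aa, ab', ba).
by move: el eg ei; case: (eval _ s) => ? ? ?; case: (eval _ t) => ? ? ? /= -> -> ->.
Qed.

Hypothesis S_domain : equational_domain (rees P).

Lemma alike_eq a b : alike a b -> a = b.
Proof.
move=> ab; apply/esym.
pose Y (j : 'I_2) := [set x | eval x (Var _ j) = eval x (Const 2 a)].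
have /algebraicP sep : algebraic (\bigcup_(j in [set: 'I_2]) Y j).
  by apply: S_domain => j; apply: algebraic_eq.
apply: contrapT => nba.
have [|[s t] /= Yst] := sep (point2 b b).
  by case=> j _; rewrite /Y /= ffunE; case: ifP.
apply; apply: (rees_equation_square ab); apply: Yst.
- by exists ord0; rewrite // /Y /= ffunE.
- by exists ord0; rewrite // /Y /= ffunE.
- by exists ord_max; rewrite // /Y /= ffunE.
Qed.

(** Multiplying by [b] on the left replaces the left index of [z] by that of [b],
and dually on the right, so an identity leaves room for only one index on each
side. *)
Lemma rees_identity_group b : (forall z, b * z = z /\ z * b = z) ->
  is_group (rees P).
Proof.
move=> bid; apply/rees_is_groupP => //; split.
  have bl (z : rees P) : rees_l z = rees_l b by rewrite -{1}(bid z).1.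
  have := bl (Rees P ord_max 1 ord0); rewrite -(bl (Rees P ord0 1 ord0)) /=.
  by move/(congr1 val).
have bi (z : rees P) : rees_i z = rees_i b by rewrite -{1}(bid z).2.
have := bi (Rees P ord0 1 ord_max); rewrite -(bi (Rees P ord0 1 ord0)) /=.
by move/(congr1 val).
Qed.

Hypothesis S_not_group : ~ is_group (rees P).

Lemma not_like_identity b : ~ forall c d, c * b * d = c * d.
Proof.
move=> b1; apply: S_not_group; apply: (@rees_identity_group b) => z.
by split; apply: alike_eq => c d; rewrite mulgA ?b1 // -mulgA b1.
Qed.

End Rees.

(** The product [c * x * d] of [S*], read as the element of [S] that it is. *)
Definition sandwich (T : semigroupType) (c d : T) (x : adjoin1 T) : T :=
  match x with Some s => c * s * d | None => c * d end.

Lemma sandwich_separates (gT : finGroupType) (m l : nat)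
    (P : 'M[gT]_(m.+1, l.+1)) (P_normalized : normalized P)
    (S_domain : equational_domain (rees P))
    (S_not_group : ~ is_group (rees P)) (a b : adjoin1 (rees P)) :
  a <> b -> exists cd, sandwich cd.1 cd.2 a <> sandwich cd.1 cd.2 b.
Proof.
move=> nab; apply: contrapT => /forallNP ab; apply: nab.
have {}ab c d : sandwich c d a = sandwich c d b.
  by apply: contrapT; apply: (ab (c, d)).
case: a b ab => [a|] [b|] //= ab.
- by congr Some; apply: alike_eq.
- by case: (not_like_identity P_normalized S_domain S_not_group ab).
- have ba c d : c * b * d = c * d by [].
  by case: (not_like_identity P_normalized S_domain S_not_group ba).
Qed.

Section Substitution.
Variables (T : semigroupType) (N n : nat).
Variables (c d : 'I_N -> T) (u : 'I_N -> term (adjoin1 T) n).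

Fixpoint sandwich_subst (t : term T N) : term (adjoin1 T) n :=
  match t with
  | Var i => Mul (Mul (Const n (Some (c i) : adjoin1 T)) (u i))
                 (Const n (Some (d i) : adjoin1 T))
  | Const s => Const n (Some s : adjoin1 T)
  | Mul t1 t2 => Mul (sandwich_subst t1) (sandwich_subst t2)
  end.

Definition sandwich_point (x : {ffun 'I_n -> adjoin1 T}) : {ffun 'I_N -> T} :=
  [ffun i => sandwich (c i) (d i) (eval x (u i))].

Lemma eval_sandwich_subst x t :
  eval x (sandwich_subst t) = Some (eval (sandwich_point x) t).
Proof.
elim: t => [i|s|t1 IH1 t2 IH2] //=; last by rewrite IH1 IH2.
by rewrite ffunE; case: (eval x (u i)).
Qed.

End Substitution.

Theorem theorem5p2 (gT : finGroupType) (m l : nat) (P : 'M[gT]_(m.+1, l.+1))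
    (P_normalized : normalized P) (S_not_group : ~ is_group (rees P))
    (S_domain : equational_domain (rees P)) :
  equational_domain (adjoin1 (rees P)).
Proof.
move=> n k Y algY; apply/algebraicP => p Yp.
have /choice[e /all_and2[Ye pe]] : forall j, exists e : equation _ n,
    (forall x, Y j x -> eval x e.1 = eval x e.2) /\ eval p e.1 <> eval p e.2.
  move=> j; have /algebraicP/(_ p)[|e Ye pe] := algY j; last by exists e.
  by move=> Yjp; apply: Yp; exists j.
have /choice[cd sep] := fun j =>
  sandwich_separates P_normalized S_domain S_not_group (@pe j).
(* The variables [lshift K j] and [rshift K j] stand for the two sides of the
   [j]-th equation. *)
pose K := k.+1.
pose side (i : 'I_(K + K)) := match split i with inl j => j | inr j => j end.
pose u (i : 'I_(K + K)) :=
  match split i with inl j => (e j).1 | inr j => (e j).2 end.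
pose c i := (cd (side i)).1; pose d i := (cd (side i)).2.
have pointl x j : sandwich_point c d u x (lshift K j)
    = sandwich (cd j).1 (cd j).2 (eval x (e j).1).
  by rewrite ffunE /c /d /u /side (unsplitK (inl j : 'I_K + 'I_K)).
have pointr x j : sandwich_point c d u x (rshift K j)
    = sandwich (cd j).1 (cd j).2 (eval x (e j).2).
  by rewrite ffunE /c /d /u /side (unsplitK (inr j : 'I_K + 'I_K)).
pose Z (j : 'I_K) := [set x : {ffun 'I_(K + K) -> rees P} |
  eval x (Var _ (lshift K j)) = eval x (Var _ (rshift K j))].
have /algebraicP/(_ (sandwich_point c d u p)) :
    algebraic (\bigcup_(j in [set: 'I_K]) Z j).
  by apply: S_domain => j; apply: algebraic_eq.
case=> [[j _]|[s t] /= Zst pst]; first by rewrite /Z /= pointl pointr => /sep.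
exists (sandwich_subst c d u s, sandwich_subst c d u t) => [x [j _ Yx]|] /=.
  rewrite !eval_sandwich_subst Zst //.
  by exists j; rewrite // /Z /= pointl pointr (Ye j x Yx).
by rewrite !eval_sandwich_subst => -[].
Qed.
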